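(* Suppose $(a_{n})_{n\geq 1}$ is a sequence of positive real numbers for which the limit \[ p=\lim_{n\to\infty}n\left(\frac{a_{n}}{a_{n+1}}-1\right) \] exists. If $0<p\leq 1$, then the series \[ \sum_{n=1}^{\infty}(-1)^{n-1}a_{n}=a_{1}-a_{2}+a_{3}-a_{4}+\cdots \] is convergent. If $0<p<1$, then this series converges conditionally.
   Context: A series is conditionally convergent if it converges but does not converge absolutely. *)

(* Defs.v *)
From Stdlib Require Import Reals.
From Coquelicot Require Import Coquelicot.

Open Scope R_scope.

Definition conditionally_convergent (u : nat -> R) : Prop :=
  ex_series u /\ ~ ex_series (fun n : nat => Rabs (u n)).

(* Coquelicot series start at index 0: the term of index n >= 1 of
   a_1 - a_2 + a_3 - ..., that is (-1)^(n-1) * a_n, sits at index n - 1.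
   The value a 0 is not used. *)
Definition alternating_terms (a : nat -> R) (k : nat) : R :=
  (-1) ^ k * a (S k).

(* Main.v *)
Require Import Defs.
From Stdlib Require Import Reals Lra Lia.
From Coquelicot Require Import Coquelicot.

Open Scope R_scope.

(** The limit p enters only through inequalities, valid from some rank on,
    between n * (a_n - a_{n+1}) and a multiple of a_{n+1}.

    If p > 0, then for q = p/2 the drop a_n - a_{n+1} is eventually at least
    q * a_{n+1} / n.  So a_n eventually decreases, to a limit L >= 0, and the
    drops form a convergent telescoping series.  If L were positive, each drop
    would be at least q * L / n, and the harmonic series would converge.  Hence
    L = 0 ([lim_0_of_relative_drop]), and Leibniz' alternating series test
    applies to a tail ([ex_series_alternating_eventually]).

    If p < 1, then eventually n * a_n <= (n + 1) * a_{n+1}.  So n * a_n stays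
    above a positive constant, and the series of the a_n dominates a multiple of
    the harmonic series ([not_ex_series_of_growing_multiple]).

    Both halves thus rest on the divergence of the harmonic series
    ([not_ex_series_ge_harmonic]).  The sequence is reindexed as
    b k = a (k + 1), which matches series that start at index 0. *)

(** Oresme's doubling argument: passing from 1/1 + ... + 1/m to twice as many
    terms adds at least 1/2.  With m = n + 1 terms the last index is n, and
    doubling moves it to 2 n + 1. *)
Lemma harmonic_sum_doubling (n : nat) :
  sum_n (fun k => / INR (S k)) n + / 2
  <= sum_n (fun k => / INR (S k)) (2 * n + 1).
Proof.
induction n as [|n IH].
- simpl Nat.add; rewrite sum_Sn, !sum_O; unfold plus; simpl; lra.
- replace (2 * S n + 1)%nat with (S (S (2 * n + 1))) by lia.
  rewrite !sum_Sn; unfold plus; cbn [AbelianMonoid.sort]; simpl in IH |- *.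
  enough (H : / INR (S (S n))
    <= / INR (S (S (2 * n + 1))) + / INR (S (S (S (2 * n + 1))))).
  { simpl in H; lra. }
  rewrite !S_INR, plus_INR, mult_INR; simpl INR.
  pose proof (pos_INR n) as Hn.
  replace (/ (INR n + 1 + 1)) with (2 * / ((1 + 1) * INR n + 1 + 1 + 1 + 1))
    by (field; lra).
  assert (/ ((1 + 1) * INR n + 1 + 1 + 1 + 1) <= / ((1 + 1) * INR n + 1 + 1 + 1))
    by (apply Rinv_le_contravar; lra).
  lra.
Qed.

Lemma not_ex_series_harmonic : ~ ex_series (fun k => / INR (S k)).
Proof.
intros [l Hl].
assert (H1 : is_lim_seq (sum_n (fun k => / INR (S k))) l) by exact Hl.
assert (H2 : is_lim_seq
  (fun n => sum_n (fun k => / INR (S k)) (2 * n + 1)) l).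
{ apply (is_lim_seq_subseq _ l (fun n => (2 * n + 1)%nat)); [|exact H1].
  apply eventually_subseq; intros n; lia. }
assert (H3 := is_lim_seq_le _ _ _ _ harmonic_sum_doubling
  (is_lim_seq_plus' _ _ _ _ H1 (is_lim_seq_const (/ 2))) H2).
simpl in H3; lra.
Qed.

Lemma not_ex_series_ge_harmonic (u : nat -> R) (c : R) :
  0 < c -> eventually (fun k => c * / INR (S k) <= u k) -> ~ ex_series u.
Proof.
intros Hc [N HN] Hu; apply not_ex_series_harmonic.
apply (ex_series_incr_n _ N).
apply (ex_series_incr_n _ N) in Hu.
apply (@ex_series_le R_AbsRing R_CompleteNormedModule _
  (fun k => / c * u (N + k)%nat)).
- intros k.
  assert (0 < / INR (S (N + k))) by (apply Rinv_0_lt_compat, lt_0_INR; lia).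
  unfold norm; simpl; unfold abs; simpl.
  change (Rabs (/ INR (S (N + k))) <= / c * u (N + k)%nat).
  rewrite Rabs_pos_eq by lra.
  apply (Rmult_le_reg_l c); [exact Hc|].
  replace (c * (/ c * u (N + k)%nat)) with (u (N + k)%nat) by (field; lra).
  apply HN; lia.
- exact (ex_series_scal (/ c) _ Hu).
Qed.

(** If n b_n is eventually nondecreasing (with the index shifted by one), it
    stays above its value at the first such rank, so b_n is at least a positive
    multiple of 1 / n. *)
Lemma not_ex_series_of_growing_multiple (b : nat -> R) :
  (forall k, 0 < b k) ->
  eventually (fun k => INR (S k) * b k <= INR (S (S k)) * b (S k)) ->
  ~ ex_series b.
Proof.
intros Hb [N HN].
apply not_ex_series_ge_harmonic with (c := INR (S N) * b N).
- apply Rmult_lt_0_compat; [apply lt_0_INR; lia | apply Hb].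
- exists N; intros k Hk.
  assert (0 < INR (S k)) by (apply lt_0_INR; lia).
  apply Rle_div_l; [assumption|].
  rewrite (Rmult_comm (b k)).
  induction Hk as [|k Hk IH]; [lra|].
  apply Rle_trans with (INR (S k) * b k); [|now apply HN].
  apply IH, lt_0_INR; lia.
Qed.

Lemma ex_series_telescope (b : nat -> R) (l : R) :
  is_lim_seq b l -> ex_series (fun k => b k - b (S k)).
Proof.
intros Hb; exists (b O - l).
assert (Hsum : forall n, b O - b (S n) = sum_n (fun k => b k - b (S k)) n).
{ induction n as [|n IH]; [now rewrite sum_O|].
  rewrite sum_Sn, <- IH; unfold plus; simpl; ring. }
apply (is_lim_seq_ext _ _ (b O - l) Hsum).
apply is_lim_seq_minus'; [apply is_lim_seq_const|].
now apply -> is_lim_seq_incr_1.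
Qed.

(** A positive limit would make the drops b k - b (S k), which sum to a finite
    value, at least as large as a multiple of the harmonic terms. *)
Lemma lim_0_of_relative_drop (b : nat -> R) (q : R) :
  (forall k, 0 < b k) -> 0 < q ->
  eventually (fun k => b (S k) <= b k) ->
  eventually (fun k => q * b (S k) <= INR (S k) * (b k - b (S k))) ->
  is_lim_seq b 0.
Proof.
intros Hb Hq [N HN] Hdrop.
assert (Hlim : ex_finite_lim_seq (fun k => b (k + N)%nat)).
{ apply ex_finite_lim_seq_decr with (M := 0).
  - intros k; apply HN; lia.
  - intros k; apply Rlt_le, Hb. }
destruct Hlim as [L HL].
assert (HL0 : 0 <= L).
{ apply (is_lim_seq_le (fun _ => 0) (fun k => b (k + N)%nat) 0 L);
    [|apply is_lim_seq_const|exact HL].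
  intros k; apply Rlt_le, Hb. }
assert (HbL : forall k, (N <= k)%nat -> L <= b k).
{ intros k Hk.
  replace k with ((k - N) + N)%nat by lia.
  apply (is_lim_seq_decr_compare _ _ HL).
  intros j; apply HN; lia. }
apply is_lim_seq_incr_n in HL.
destruct (Rle_lt_or_eq_dec _ _ HL0) as [HLpos | <-]; [exfalso | exact HL].
apply (not_ex_series_ge_harmonic (fun k => b k - b (S k)) (q * L)).
- now apply Rmult_lt_0_compat.
- destruct Hdrop as [M HM]; exists (max M N); intros k Hk.
  assert (0 < INR (S k)) by (apply lt_0_INR; lia).
  apply Rle_div_l; [assumption|].
  rewrite (Rmult_comm (b k - b (S k))).
  apply Rle_trans with (q * b (S k)).
  + apply Rmult_le_compat_l; [lra | apply HbL; lia].
  + apply HM; lia.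
- exact (ex_series_telescope _ _ HL).
Qed.

(** Leibniz' test on a tail; starting at rank N multiplies the terms by the
    constant sign (-1)^N. *)
Lemma ex_series_alternating_eventually (b : nat -> R) :
  eventually (fun k => b (S k) <= b k) -> is_lim_seq b 0 ->
  ex_series (fun k => (-1) ^ k * b k).
Proof.
intros [N HN] Hlim.
apply (ex_series_incr_n _ N).
destruct (alternated_series (fun k => b (k + N)%nat)) as [l Hl].
- intros k; apply HN; lia.
- apply is_lim_seq_Reals.
  now apply (is_lim_seq_incr_n b N).
- apply (ex_series_ext
    (fun k => scal ((-1) ^ N) (tg_alt (fun k => b (k + N)%nat) k))).
  + intros k; unfold scal, tg_alt; simpl; unfold mult; simpl.
    rewrite pow_add, (Nat.add_comm N k); ring.
  + apply (@ex_series_scal R_AbsRing R_NormedModule ((-1) ^ N)).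
    exists l; apply is_series_Reals; exact Hl.
Qed.

(** Bounds on Raabe's quotient freed from the division; x and y stand for
    consecutive terms of the sequence, n for the rank of x. *)
Lemma raabe_quotient_bound (n x y q : R) :
  0 < y ->
  (q <= n * (x / y - 1) -> q * y <= n * (x - y)) /\
  (n * (x / y - 1) <= q -> n * (x - y) <= q * y).
Proof.
intros Hy.
replace (n * (x - y)) with (n * (x / y - 1) * y) by (field; lra).
split; intros H; apply Rmult_le_compat_r; lra.
Qed.

Theorem theorem3 (a : nat -> R) (p : R)
  (ha : forall n : nat, (1 <= n)%nat -> 0 < a n)
  (hp : is_lim_seq (fun n : nat => INR n * (a n / a (S n) - 1)) (Finite p)) :
  (0 < p <= 1 -> ex_series (alternating_terms a)) /\
  (0 < p < 1 -> conditionally_convergent (alternating_terms a)).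
Proof.
set (b := fun k => a (S k)).
assert (Hb : forall k, 0 < b k) by (intros k; apply ha; lia).
assert (Hr : is_lim_seq (fun k => INR (S k) * (b k / b (S k) - 1)) p)
  by (now apply is_lim_seq_incr_1 in hp).
assert (Hconv : 0 < p -> ex_series (alternating_terms a)).
{ intros Hp.
  assert (Hdrop : eventually
    (fun k => p / 2 * b (S k) <= INR (S k) * (b k - b (S k)))).
  { assert (Hp2 : 0 < p / 2) by lra.
    destruct (proj2 (is_lim_seq_spec _ _) Hr (mkposreal _ Hp2)) as [N HN].
    exists N; intros k Hk; specialize (HN k Hk); simpl pos in HN.
    apply Rabs_def2 in HN.
    apply raabe_quotient_bound; [apply Hb | lra]. }
  assert (Hdecr : eventually (fun k => b (S k) <= b k)).
  { destruct Hdrop as [N HN]; exists N; intros k Hk; specialize (HN k Hk).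
    assert (0 < INR (S k)) by (apply lt_0_INR; lia).
    assert (0 < p / 2 * b (S k))
      by (apply Rmult_lt_0_compat; [lra | apply Hb]).
    nra. }
  apply (ex_series_alternating_eventually b Hdecr).
  apply (lim_0_of_relative_drop b (p / 2)); auto; lra. }
split; [intros [Hp _]; now apply Hconv|].
intros [Hp0 Hp1]; split; [now apply Hconv|].
intros Habs.
apply (not_ex_series_of_growing_multiple b Hb).
- assert (Hp : 0 < 1 - p) by lra.
  destruct (proj2 (is_lim_seq_spec _ _) Hr (mkposreal _ Hp)) as [N HN].
  exists N; intros k Hk; specialize (HN k Hk); simpl pos in HN.
  apply Rabs_def2 in HN.
  assert (H : INR (S k) * (b k - b (S k)) <= 1 * b (S k))
    by (apply raabe_quotient_bound; [apply Hb | lra]).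
  rewrite (S_INR (S k)); lra.
- apply (ex_series_ext (fun k => Rabs (alternating_terms a k))); [|exact Habs].
  intros k; unfold alternating_terms.
  rewrite Rabs_mult, pow_1_abs, Rmult_1_l.
  apply Rabs_pos_eq, Rlt_le, Hb.
Qed.
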